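(* Let $I\subset\mathbb C[z]=\mathbb C[z_1,\ldots,z_n]$ be a homogeneous ideal and let $M=\overline I$ be its closure in the Hardy space $H^2(\mathbb D^n)$. Then $M$ is a homogeneous closed $M_z$-invariant subspace and $I=\bigoplus_{k\ge0}M\cap\mathbb H_k$ (algebraic direct sum). Moreover, let $0\le k_1<\ldots<k_r$ and $N_1,\ldots,N_r\ge1$ be integers and let $p^s_j\in\mathbb H_{k_s}$ ($1\le s\le r$, $1\le j\le N_s$) be non-zero homogeneous polynomials generating $I$. For $s=1,\ldots,r$ successively put $$Y_s=\{z^\alpha q:\ 1\le t<s,\ q\in B_t,\ \alpha\in\mathbb N^n,\ |\alpha|=k_s-k_t\}$$ and let $B_s\subset\mathbb H_{k_s}$ be the finite (possibly empty) set of non-zero vectors which the Gram–Schmidt orthogonalization procedure in $H^2(\mathbb D^n)$, applied to an enumeration of $Y_s$ followed by $p^s_1,\ldots,p^s_{N_s}$, produces from $p^s_1,\ldots,p^s_{N_s}$. Then $B_1\cup\ldots\cup B_r$ is a minimal set of homogeneous generators of the ideal $I$.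
   Context: $\mathbb N=\{0,1,2,\ldots\}$. $H^2(\mathbb D^n)$ is the Hardy space on the unit polydisc (the Hilbert space completion of $\mathbb C[z]$ in which the monomials $z^\alpha$, $\alpha\in\mathbb N^n$, form an orthonormal basis). $\mathbb H_k$ is the space of homogeneous polynomials of degree $k$ (with respect to total degree); $H^2(\mathbb D^n)$ is the orthogonal direct sum of the $\mathbb H_k$. $M_z=(M_{z_1},\ldots,M_{z_n})$ is the tuple of multiplication operators with the coordinate functions. An ideal is homogeneous if it is generated by homogeneous polynomials. A closed subspace $M$ is homogeneous if it is the closed linear span of the spaces $M\cap\mathbb H_k$, $k\in\mathbb N$. A minimal set of generators is a generating set with the smallest possible number of elements. In the Gram–Schmidt procedure vectors that are linearly dependent on their predecessors are discarded. *)

(* Defs.v *)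
From HB Require Import structures.
From mathcomp Require Import all_boot all_order all_algebra complex.
(* mpoly has to be loaded before the analysis files (notation levels clash). *)
From mathcomp Require Import mpoly.
From mathcomp Require Import boolp classical_sets functions cardinality fsbigop.
From mathcomp Require Import reals ereal topology normedtype esum.
From mathcomp Require Import ring lra.

Set Implicit Arguments.
Unset Strict Implicit.
Unset Printing Implicit Defensive.

Import Order.TTheory GRing.Theory Num.Theory.
Import numFieldNormedType.Exports.

Local Open Scope classical_set_scope.
Local Open Scope ring_scope.
Local Open Scope complex_scope.
Local Open Scope card_scope.

Local Notation normc := ComplexField.Normc.normc.

(* The Hardy space H^2(D^n), as the space of square-summable families of
   Taylor coefficients indexed by N^n = 'X_{1..n}. *)
Section SquareSummable.
Context (R : realType) (n : nat).
Implicit Types (f g : 'X_{1..n} -> R[i]) (s : seq 'X_{1..n}).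

Definition esum_sq f : \bar R :=
  (\esum_(m in [set: 'X_{1..n}]) (normc (f m) ^+ 2)%:E)%E.

Definition square_summable : {pred 'X_{1..n} -> R[i]} :=
  fun f => (esum_sq f < +oo)%E.

Definition l2norm f : R := Num.sqrt (fine (esum_sq f)).

Lemma normc_ge0 (z : R[i]) : 0 <= normc z.
Proof. by case: z => a b; exact: sqrtr_ge0. Qed.

Lemma sqr_normc0 : normc (0 : R[i]) ^+ 2 = 0.
Proof. by rewrite (ComplexField.Normc.normc0 R) expr0n. Qed.

Lemma esum_sq_ge0 f : (0 <= esum_sq f)%E.
Proof. by apply: esum_ge0 => m _; rewrite lee_fin sqr_ge0. Qed.

Lemma l2norm_ge0 f : 0 <= l2norm f.
Proof. exact: sqrtr_ge0. Qed.

Lemma square_summable_sum_le f s : f \in square_summable -> uniq s ->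
  \sum_(m <- s) normc (f m) ^+ 2 <= l2norm f ^+ 2.
Proof.
rewrite -[f \in _]/(esum_sq f < +oo)%E => fs us.
have ffin : esum_sq f \is a fin_num by rewrite ge0_fin_numE ?esum_sq_ge0.
rewrite sqr_sqrtr; last by apply: fine_ge0; exact: esum_sq_ge0.
rewrite -lee_fin fineK// -sumEFin.
apply: esum_ge; exists [set` s]; first by split => //; exact: finite_seq.
by rewrite -fsbig_seq.
Qed.

Lemma square_summable_bound f (c : R) : 0 <= c ->
  (forall s, uniq s -> \sum_(m <- s) normc (f m) ^+ 2 <= c ^+ 2) ->
  f \in square_summable /\ l2norm f <= c.
Proof.
move=> c0 H.
have le_c : (esum_sq f <= (c ^+ 2)%:E)%E.
  apply: ge_ereal_sup => _ [X [finX _] <-].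
  rewrite fsbig_finite//= sumEFin lee_fin; apply: H; exact: finmap.fset_uniq.
have lty : (esum_sq f < +oo)%E by apply: le_lt_trans le_c _; rewrite ltry.
split => //.
have ffin : esum_sq f \is a fin_num by rewrite ge0_fin_numE ?esum_sq_ge0.
rewrite -(ger0_norm c0) -sqrtr_sqr; apply: ler_wsqrtr.
by rewrite -lee_fin fineK.
Qed.

Lemma sum_sqrD_le (a b : 'X_{1..n} -> R) (A B : R) s :
  0 <= A -> 0 <= B ->
  \sum_(m <- s) a m ^+ 2 <= A ^+ 2 -> \sum_(m <- s) b m ^+ 2 <= B ^+ 2 ->
  \sum_(m <- s) (a m + b m) ^+ 2 <= (A + B) ^+ 2.
Proof.
have z (c : 'X_{1..n} -> R) : \sum_(m <- s) c m ^+ 2 <= 0 ^+ 2 ->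
    {in s, forall m, c m = 0}.
  rewrite expr0n /= => H m ms; apply/eqP; rewrite -sqrf_eq0.
  have : \sum_(i <- s) c i ^+ 2 == 0.
    by rewrite eq_le H sumr_ge0// => i _; rewrite sqr_ge0.
  by rewrite psumr_eq0 => [/allP/(_ m ms)//|i _]; rewrite sqr_ge0.
rewrite le_eqVlt => /predU1P[<- B0 /z a0 Hb|A0].
  rewrite add0r; apply: le_trans Hb; rewrite big_seq [leRHS]big_seq.
  by apply: ler_sum => m ms; rewrite a0// add0r.
rewrite le_eqVlt => /predU1P[<- Ha /z b0|B0 Ha Hb].
  rewrite addr0; apply: le_trans Ha; rewrite big_seq [leRHS]big_seq.
  by apply: ler_sum => m ms; rewrite b0// addr0.
apply: (@le_trans _ _ ((1 + B / A) * \sum_(m <- s) a m ^+ 2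
                     + (1 + A / B) * \sum_(m <- s) b m ^+ 2)).
  rewrite !mulr_sumr -big_split /=; apply: ler_sum => m _.
  rewrite -subr_ge0.
  have -> : (1 + B / A) * a m ^+ 2 + (1 + A / B) * b m ^+ 2 - (a m + b m) ^+ 2
          = (B * a m - A * b m) ^+ 2 / (A * B).
    by field; rewrite !gt_eqF.
  by rewrite divr_ge0 ?sqr_ge0// mulr_ge0// ltW.
have -> : (A + B) ^+ 2 = (1 + B / A) * A ^+ 2 + (1 + A / B) * B ^+ 2.
  by field; rewrite !gt_eqF.
by rewrite lerD// ler_wpM2l// addr_ge0// divr_ge0// ltW.
Qed.

Lemma l2normD f g : f \in square_summable -> g \in square_summable ->
  (f + g)%R \in square_summable /\ l2norm (f + g)%R <= l2norm f + l2norm g.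
Proof.
move=> fs gs; apply: square_summable_bound; first by rewrite addr_ge0 ?l2norm_ge0.
move=> s us.
apply: le_trans (sum_sqrD_le (l2norm_ge0 f) (l2norm_ge0 g)
  (square_summable_sum_le fs us) (square_summable_sum_le gs us)).
apply: ler_sum => m _; rewrite ler_sqr ?nnegrE ?addr_ge0 ?normc_ge0//.
exact: (@le_normcD R (f m) (g m)).
Qed.

Lemma l2normZ_le (a : R[i]) f : f \in square_summable ->
  (a *: f) \in square_summable /\ l2norm (a *: f) <= normc a * l2norm f.
Proof.
move=> fs; apply: square_summable_bound; first by rewrite mulr_ge0 ?normc_ge0 ?l2norm_ge0.
move=> s us; rewrite exprMn.
under eq_bigr => m _ do rewrite (ComplexField.Normc.normcM a (f m)) exprMn.
by rewrite -mulr_sumr ler_wpM2l ?sqr_ge0// square_summable_sum_le.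
Qed.

Lemma l2norm0 : (0 : 'X_{1..n} -> R[i]) \in square_summable /\
  l2norm (0 : 'X_{1..n} -> R[i]) <= 0.
Proof.
apply: square_summable_bound => // s _.
rewrite big1 ?expr0n//= => m _.
exact: sqr_normc0.
Qed.

Lemma square_summable_submod : submod_closed square_summable.
Proof.
split; first by case: l2norm0.
move=> a f g fs gs.
by case: (l2normD (l2normZ_le a fs).1 gs).
Qed.

HB.instance Definition _ := GRing.isSubmodClosed.Build _ _ square_summable
  square_summable_submod.

Record hardy := Hardy {
  hardy_coef :> 'X_{1..n} -> R[i];
  hardy_coefP : hardy_coef \in square_summable }.

HB.instance Definition _ := [isSub for hardy_coef].
HB.instance Definition _ := [Choice of hardy by <:].
HB.instance Definition _ := [SubChoice_isSubLmodule of hardy by <:].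

Definition hardy_norm (f : hardy) : R[i] := (l2norm f)%:C.

Lemma hardy_normD (f g : hardy) : hardy_norm (f + g) <= hardy_norm f + hardy_norm g.
Proof.
rewrite /hardy_norm -rmorphD lecR.
by case: (l2normD (hardy_coefP f) (hardy_coefP g)).
Qed.

Lemma hardy_normZ (a : R[i]) (f : hardy) : hardy_norm (a *: f) = `|a| * hardy_norm f.
Proof.
have E : `|a| = (normc a)%:C by rewrite normc_def; case: a.
rewrite E /hardy_norm -rmorphM; congr (_%:C).
apply/eqP; rewrite eq_le (l2normZ_le a (hardy_coefP f)).2 /=.
have [->|a0] := eqVneq a 0.
  by rewrite (ComplexField.Normc.normc0 R) mul0r l2norm_ge0.
have n0 : 0 < normc a.
  rewrite lt_def normc_ge0 andbT; apply: contra_neq a0.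
  exact: ComplexField.Normc.eq0_normc.
have := (l2normZ_le a^-1 (hardy_coefP (a *: f))).2.
rewrite ComplexField.Normc.normcV.
have -> : a^-1 *: (hardy_coef (a *: f)) = hardy_coef f.
  by rewrite [hardy_coef (a *: f)]/= scalerA mulVf// scale1r.
by rewrite ler_pdivlMl.
Qed.

Lemma hardy_norm0_eq0 (f : hardy) : hardy_norm f = 0 -> f = 0.
Proof.
move=> /(@complexI R) f0; apply/val_inj/funext => m /=.
have := @square_summable_sum_le f [:: m] (hardy_coefP f) isT.
rewrite big_seq1 f0 expr0n /= => H.
have : normc (f m) ^+ 2 == 0 by rewrite eq_le H sqr_ge0.
by rewrite sqrf_eq0 => /eqP/ComplexField.Normc.eq0_normc.
Qed.

HB.instance Definition _ := Lmodule_isNormed.Build R[i] hardy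
  hardy_normD hardy_normZ hardy_norm0_eq0.

End SquareSummable.

Section Operators.
Context (R : realType) (n : nat).

Lemma mpoly_sum_sq_le (p : {mpoly R[i][n]}) (s : seq 'X_{1..n}) : uniq s ->
  \sum_(m <- s) normc (p@_m) ^+ 2 <= \sum_(m <- msupp p) normc (p@_m) ^+ 2.
Proof.
move=> us.
rewrite (bigID (fun m => m \in msupp p)) /= [X in _ + X]big1 ?addr0; last first.
  by move=> m /memN_msupp_eq0 ->; exact: sqr_normc0.
rewrite -big_filter [leRHS](bigID (fun m => m \in s)) /= -[X in _ <= X + _]big_filter.
rewrite (perm_big [seq m <- msupp p | m \in s]); last first.
  apply: uniq_perm; rewrite ?filter_uniq ?msupp_uniq// => m.
  by rewrite !mem_filter andbC.
by rewrite lerDl sumr_ge0// => m _; rewrite sqr_ge0.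
Qed.

Lemma mpoly_l2 (p : {mpoly R[i][n]}) :
  (fun m => p@_m) \in @square_summable R n /\
  l2norm (fun m => p@_m) <= Num.sqrt (\sum_(m <- msupp p) normc (p@_m) ^+ 2).
Proof.
apply: square_summable_bound; first exact: sqrtr_ge0.
move=> s us; rewrite sqr_sqrtr; first exact: mpoly_sum_sq_le.
by apply: sumr_ge0 => m _; rewrite sqr_ge0.
Qed.

Definition hardy_of_mpoly (p : {mpoly R[i][n]}) : hardy R n :=
  Hardy (mpoly_l2 p).1.

(* The coefficient family of z_i * f. *)
Definition shift_coef (i : 'I_n) (f : 'X_{1..n} -> R[i]) (m : 'X_{1..n}) : R[i] :=
  if m i == 0%N then 0 else f (m - U_(i))%MM.

Lemma shift_l2 (i : 'I_n) (f : hardy R n) : shift_coef i f \in @square_summable R n.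
Proof.
suff: shift_coef i f \in @square_summable R n /\ l2norm (shift_coef i f) <= l2norm f by case.
apply: square_summable_bound; first exact: l2norm_ge0.
move=> s us; rewrite (bigID (fun m : 'X_{1..n} => m i == 0%N)) /= big1 ?add0r; last first.
  by move=> m m0; rewrite /shift_coef m0 (ComplexField.Normc.normc0 R) expr0n.
under eq_bigr => m m0 do rewrite /shift_coef (negbTE m0).
rewrite -big_filter -(big_map (fun m => (m - U_(i))%MM) xpredT (fun m => normc (f m) ^+ 2)).
apply: square_summable_sum_le; first exact: hardy_coefP.
rewrite map_inj_in_uniq ?filter_uniq// => m m'; rewrite !mem_filter.
move=> /andP[m0 _] /andP[m0' _] E.
have K (m1 : 'X_{1..n}) : m1 i != 0%N -> (m1 - U_(i) + U_(i))%MM = m1.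
  by move=> ?; rewrite submK// lep1mP.
by rewrite -(K m)// E K.
Qed.

Definition Mz (i : 'I_n) (f : hardy R n) : hardy R n := Hardy (shift_l2 i f).

(* The space H_k, inside the Hardy space. *)
Definition hardy_homog (k : nat) : set (hardy R n) :=
  hardy_of_mpoly @` [set p | p \is k.-homog].

Definition closed_subspace (M : set (hardy R n)) : Prop :=
  [/\ M 0, forall (a : R[i]) f g, M f -> M g -> M (a *: f + g) & closed M].

Definition Mz_invariant (M : set (hardy R n)) : Prop :=
  forall i, Mz i @` M `<=` M.

Definition homogeneous_subspace (M : set (hardy R n)) : Prop :=
  M = smallest closed_subspace (\bigcup_k (M `&` hardy_homog k)).

(* The inner product of H^2(D^n) restricted to polynomials, for which the
   monomials are orthonormal; it induces the norm of [hardy], see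
   [hardy_of_mpoly_isometry]. *)
Definition mpdot (p q : {mpoly R[i][n]}) : R[i] :=
  \sum_(m <- msupp p) p@_m * (q@_m)^*.

Lemma hardy_of_mpoly_isometry (p : {mpoly R[i][n]}) :
  `|hardy_of_mpoly p| ^+ 2 = mpdot p p.
Proof.
have -> : mpdot p p = (\sum_(m <- msupp p) normc (p@_m) ^+ 2)%:C.
  rewrite rmorph_sum /mpdot; apply: eq_bigr => m _.
  by rewrite -sqr_normc normc_def rmorphXn; case: (p@_m).
rewrite -[`|_|]/(hardy_norm _) /hardy_norm -rmorphXn /=; congr (_%:C).
apply/eqP; rewrite eq_le; apply/andP; split; last first.
  exact: square_summable_sum_le (hardy_coefP (hardy_of_mpoly p)) (msupp_uniq p).
have := (mpoly_l2 p).2; rewrite -ler_sqr ?nnegrE ?l2norm_ge0 ?sqrtr_ge0//.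
by rewrite [X in _ <= X -> _]sqr_sqrtr// sumr_ge0// => m _; rewrite sqr_ge0.
Qed.

(* Unnormalised Gram-Schmidt; a vector with zero residue is discarded. *)
Definition gram_schmidt_step (us : seq {mpoly R[i][n]}) (v : {mpoly R[i][n]}) :=
  let u := v - \sum_(w <- us) (mpdot v w / mpdot w w) *: w in
  if u == 0 then us else rcons us u.

Definition gram_schmidt (vs : seq {mpoly R[i][n]}) : seq {mpoly R[i][n]} :=
  foldl gram_schmidt_step [::] vs.

(* The part of the Gram-Schmidt output on [ys ++ ps] that stems from [ps]. *)
Definition gram_schmidt_after (ys ps : seq {mpoly R[i][n]}) :
    seq {mpoly R[i][n]} :=
  drop (size (gram_schmidt ys)) (gram_schmidt (ys ++ ps)).

End Operators.

(* The library's ideals are proper; the unit ideal has to be allowed here. *)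
Definition is_ideal (A : comNzRingType) (I : set A) : Prop :=
  [/\ I 0, forall p q, I p -> I q -> I (p + q) & forall a p, I p -> I (a * p)].

Definition ideal_gen (A : comNzRingType) (S : set A) : set A :=
  smallest (@is_ideal A) S.

Definition homogeneous_ideal (K : comNzRingType) (n : nat)
    (I : set {mpoly K[n]}) : Prop :=
  is_ideal I /\
  exists2 S : set {mpoly K[n]}, (forall p, S p -> p \is homog mdeg) &
    ideal_gen S = I.

Definition minimal_generators (A : comNzRingType) (I G : set A) : Prop :=
  [/\ finite_set G, ideal_gen G = I &
      forall G' : set A, ideal_gen G' = I -> G #<= G'].

(* [A] is the algebraic direct sum of the subspaces [S k]: it consists of the
   finite sums of elements of the [S k], and the [S k] are independent. *)
Definition algebraic_direct_sum (V : zmodType) (A : set V) (S : nat -> set V) :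
    Prop :=
  A = [set x | exists d (f : nat -> V),
         (forall k, (k < d)%N -> S k (f k)) /\ x = \sum_(k < d) f k] /\
  (forall d (f : nat -> V), (forall k, (k < d)%N -> S k (f k)) ->
     \sum_(k < d) f k = 0 -> forall k, (k < d)%N -> f k = 0).

(* Main.v *)
(* The closure of I is a closed invariant subspace because multiplication by a
   coordinate is a contraction.  As I contains the homogeneous components of its
   elements, a polynomial p of degree k outside I is separated from I by a
   functional in finitely many Taylor coefficients of degree k; such functionals
   are continuous, so p is not in the closure of I either.

   The generators in B_s are orthogonal to each other and to Y_s, which spans
   the degree k_s part of the products of earlier generators with nonconstant
   monomials.  Hence no nontrivial linear combination of the generators lies in
   m I, where m is the irrelevant ideal: their classes form a basis of I / m I,
   and every generating set has at least dim (I / m I) elements. *)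

Require Import Defs.
From mathcomp Require Import all_boot all_order all_algebra complex.
From mathcomp Require Import mpoly.
From mathcomp Require Import boolp classical_sets functions cardinality.
From mathcomp Require Import reals topology normedtype.

Set Implicit Arguments.
Unset Strict Implicit.
Unset Printing Implicit Defensive.

Import Order.TTheory GRing.Theory Num.Theory.
Import numFieldNormedType.Exports.

Local Open Scope classical_set_scope.
Local Open Scope ring_scope.
Local Open Scope complex_scope.
Local Open Scope card_scope.

(** * Null vectors and finitely generated ideals *)

(** A matrix with more rows than columns has a nontrivial left kernel. The rows are indexed by a
    finite type because the generators will be indexed by dependent pairs. *)
Lemma exists_left_null (K : fieldType) (T : finType) (M : nat)
    (P : T -> 'I_M -> K) : (M < #|T|)%N ->
  exists2 v : T -> K, (exists u, v u != 0) &
    forall j, \sum_u v u * P u j = 0.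
Proof.
move=> ltM; pose A : 'M[K]_(#|T|, M) := \matrix_(i, j) P (enum_val i) j.
have /rowV0Pn[w /sub_kermxP wA /rV0Pn[i wi]] : kermx A != 0.
  rewrite kermx_eq0 /row_free; apply: contraTneq ltM => rA.
  by rewrite -leqNgt -rA rank_leq_col.
exists (fun u => w 0 (enum_rank u)).
  by exists (enum_val i); rewrite enum_valK.
move=> j; have /matrixP/(_ 0 j) := wA; rewrite !mxE => {2}<-.
rewrite (reindex _ (onW_bij _ (@enum_val_bij T))) /=.
by apply: eq_bigr => i' _; rewrite enum_valK mxE.
Qed.

Section Ideals.
Context (A : comNzRingType).
Implicit Types (S I : set A) (T : finType).

Lemma ideal_gen_ideal S : is_ideal (ideal_gen S).
Proof.
split.
- by move=> J [[]].
- by move=> p q Sp Sq J JS; case: (JS) => -[_ JD _] _; apply: JD; [exact: Sp|exact: Sq].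
- by move=> a p Sp J JS; case: (JS) => -[_ _ JM] _; apply: JM; exact: Sp.
Qed.

Lemma ideal_gen_sub S I : is_ideal I -> S `<=` I -> ideal_gen S `<=` I.
Proof. exact: smallest_sub. Qed.

Lemma mem_ideal_gen S : S `<=` ideal_gen S.
Proof. exact: sub_gen_smallest. Qed.

Lemma ideal_sum I (X : Type) (r : seq X) (P : pred X) (F : X -> A) :
  is_ideal I -> (forall i, P i -> I (F i)) -> I (\sum_(i <- r | P i) F i).
Proof. by move=> [I0 ID _]; apply: big_ind. Qed.

Lemma ideal_gen_range T (g : T -> A) x : ideal_gen (range g) x ->
  exists c : T -> A, x = \sum_u c u * g u.
Proof.
apply: (ideal_gen_sub (I := [set x | exists c : T -> A, x = \sum_u c u * g u])).
  split.
  - by exists (fun=> 0); rewrite big1// => u _; rewrite mul0r.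
  - move=> _ _ [c ->] [d ->]; exists (fun u => c u + d u).
    by rewrite -big_split; apply: eq_bigr => u _; rewrite mulrDl.
  - move=> a _ [c ->]; exists (fun u => a * c u).
    by rewrite mulr_sumr; apply: eq_bigr => u _; rewrite mulrA.
move=> _ [u _ <-]; exists (fun w => (w == u)%:R).
rewrite (bigD1 u)//= eqxx mul1r big1 ?addr0// => w /negPf ->.
by rewrite mul0r.
Qed.

End Ideals.

(** * The inner product on polynomials and the Gram-Schmidt procedure *)

Section GramSchmidt.
Context (R : realType) (n : nat).
Local Notation P := {mpoly R[i][n]}.
Implicit Types (p q u v w : P) (us vs : seq P).

(** Only the common support contributes. Summing over the support of the right argument makes
    linearity in the left one immediate. *)
Lemma mpdotEr p q : mpdot p q = \sum_(m <- msupp q) p@_m * (q@_m)^*.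
Proof.
rewrite /mpdot (bigID (mem (msupp q))) /= [X in _ + X]big1 ?addr0; last first.
  by move=> m /memN_msupp_eq0 ->; rewrite rmorph0 mulr0.
rewrite [RHS](bigID (mem (msupp p))) /= [X in _ = _ + X]big1 ?addr0; last first.
  by move=> m /memN_msupp_eq0 ->; rewrite mul0r.
rewrite -[LHS]big_filter -[RHS]big_filter; apply/perm_big/uniq_perm.
- by rewrite filter_uniq.
- by rewrite filter_uniq.
- by move=> m; rewrite !mem_filter andbC.
Qed.

Lemma mpdotDl p p' q : mpdot (p + p') q = mpdot p q + mpdot p' q.
Proof.
by rewrite !mpdotEr -big_split; apply: eq_bigr => m _; rewrite mcoeffD mulrDl.
Qed.

Lemma mpdotZl a p q : mpdot (a *: p) q = a * mpdot p q.
Proof.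
by rewrite !mpdotEr mulr_sumr; apply: eq_bigr => m _; rewrite mcoeffZ mulrA.
Qed.

Lemma mpdot0l q : mpdot 0 q = 0.
Proof. by rewrite -[in LHS](scale0r (0 : P)) mpdotZl mul0r. Qed.

Lemma mpdotBl p p' q : mpdot (p - p') q = mpdot p q - mpdot p' q.
Proof. by rewrite mpdotDl -scaleN1r mpdotZl mulN1r. Qed.

Lemma mpdot_suml (T : Type) (r : seq T) (S : pred T) (F : T -> P) q :
  mpdot (\sum_(i <- r | S i) F i) q = \sum_(i <- r | S i) mpdot (F i) q.
Proof.
by elim/big_rec2: _ => [|i x y _ <-]; rewrite ?mpdot0l ?mpdotDl.
Qed.

Lemma mpdotC p q : mpdot q p = (mpdot p q)^*.
Proof.
rewrite mpdotEr /mpdot rmorph_sum; apply: eq_bigr => m _.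
by rewrite rmorphM /= conjcK mulrC.
Qed.

Lemma mpdot_sym0 p q : (mpdot p q == 0) = (mpdot q p == 0).
Proof. by rewrite [in RHS]mpdotC fmorph_eq0. Qed.

Lemma mpdot_eq0 p : (mpdot p p == 0) = (p == 0).
Proof.
rewrite -hardy_of_mpoly_isometry sqrf_eq0 normr_eq0.
apply/eqP/eqP => [p0|->].
  apply/mpolyP => m; rewrite mcoeff0.
  by have /(congr1 (@hardy_coef R n)) := p0; move=> /(congr1 (@^~ m)).
by apply/val_inj/funext => m /=; rewrite mcoeff0.
Qed.

Lemma gram_schmidt_step_cat us v : exists ws, gram_schmidt_step us v = us ++ ws.
Proof.
rewrite /gram_schmidt_step; case: ifP => _; first by exists [::]; rewrite cats0.
by eexists [:: _]; rewrite cats1.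
Qed.

(** Each step only appends, so the output on [ys] is a prefix of the output on [ys ++ ps] and [drop]
    removes exactly that prefix. *)
Lemma gram_schmidt_cat ys ps :
  gram_schmidt (ys ++ ps) = gram_schmidt ys ++ @gram_schmidt_after R n ys ps.
Proof.
have [ws E] : exists ws, gram_schmidt (ys ++ ps) = gram_schmidt ys ++ ws.
  elim/last_ind: ps => [|ps p [ws IH]]; first by exists [::]; rewrite !cats0.
  rewrite -rcons_cat /gram_schmidt foldl_rcons -/(gram_schmidt _) IH.
  have [ws' ->] := gram_schmidt_step_cat (gram_schmidt ys ++ ws) p.
  by exists (ws ++ ws'); rewrite catA.
by rewrite /gram_schmidt_after E drop_size_cat.
Qed.

Definition orthogonal_system us :=
  pairwise (fun u w => mpdot u w == 0) us && all (predC1 0) us.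

Lemma orthogonal_system_uniq us : orthogonal_system us -> uniq us.
Proof.
rewrite uniq_pairwise => /andP[]; elim: us => //= u us IH /andP[ou pus].
move=> /andP[u0 us0]; rewrite IH// andbT; apply: sub_all ou => w.
by apply: contraTneq => <-; rewrite mpdot_eq0.
Qed.

Lemma orthogonal_systemP us : orthogonal_system us ->
  {in us &, forall u w, u != w -> mpdot u w = 0}.
Proof.
move=> /andP[+ _] u w; elim: us => //= x us IH /andP[/allP xu pus].
rewrite !inE => /predU1P[->|uus] /predU1P[->|wus].
- by rewrite eqxx.
- by move=> _; apply/eqP/xu.
- by move=> _; apply/eqP; rewrite mpdot_sym0; apply: xu.
- exact: IH.
Qed.

Lemma gram_schmidt_orthogonal vs : orthogonal_system (gram_schmidt vs).
Proof.
elim/last_ind: vs => // vs v IH.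
rewrite /gram_schmidt foldl_rcons -/(gram_schmidt _) /gram_schmidt_step.
set us := gram_schmidt vs in IH *; set u := v - _.
case: eqVneq => // u0; have /andP[pus us0] := IH.
rewrite /orthogonal_system pairwise_rcons pus all_rcons /= u0 us0 !andbT.
apply/allP => w wus; rewrite mpdot_sym0 /u.
have -> : mpdot (v - \sum_(w0 <- us) (mpdot v w0 / mpdot w0 w0) *: w0) w =
    mpdot v w - \sum_(w0 <- us) (mpdot v w0 / mpdot w0 w0) * mpdot w0 w.
  rewrite mpdotBl mpdot_suml; congr (_ - _).
  by apply: eq_bigr => w0 _; rewrite mpdotZl.
rewrite (bigD1_seq w)//= ?orthogonal_system_uniq// big_seq_cond.
rewrite big1 ?addr0 => [|w0 /andP[w0us w0w]]; last first.
  by rewrite (orthogonal_systemP IH w0us wus w0w) mulr0.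
by rewrite divfK ?subrr// mpdot_eq0; exact: (allP us0).
Qed.

(** Input and output have the same span, expressed by testing against every subspace [W]: a step
    changes [v] only by a combination of earlier outputs, and a discarded [v] equals such a
    combination. *)
Lemma gram_schmidt_span (W : set P) vs :
  W 0 -> (forall a p q, W p -> W q -> W (a *: p + q)) ->
  (forall v, v \in vs -> W v) <-> (forall u, u \in gram_schmidt vs -> W u).
Proof.
move=> W0 WD; elim/last_ind: vs => // vs v IH.
rewrite /gram_schmidt foldl_rcons -/(gram_schmidt _) /gram_schmidt_step.
set us := gram_schmidt vs in IH *.
have Wsum (c : P -> R[i]) : (forall u, u \in us -> W u) ->
    W (\sum_(w <- us) c w *: w).
  move=> H; rewrite big_seq; apply: big_ind => // [p q Wp Wq|w wus].
    by rewrite -[p]scale1r; apply: WD.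
  by rewrite -[_ *: _]addr0; apply: WD => //; apply: H.
set s := \sum_(_ <- us) _.
have Wv : (forall u, u \in us -> W u) -> W v <-> W (v - s).
  move=> H; have Ws : W s by apply: Wsum.
  split => Wv; first by rewrite addrC -scaleN1r; apply: WD.
  by rewrite -[v](subrK s) -[v - s]scale1r; apply: WD.
have rconsE (x : P) xs : (forall u, u \in rcons xs x -> W u) <->
    (forall u, u \in xs -> W u) /\ W x.
  split=> [H|[H Wx] u]; last by rewrite mem_rcons inE => /predU1P[->//|/H].
  by split=> [u uxs|]; apply: H; rewrite mem_rcons inE ?uxs ?orbT ?eqxx.
rewrite rconsE IH; case: eqVneq => [u0|_]; last first.
  by rewrite rconsE; split=> -[H]; rewrite ?Wv//; split => //; apply/Wv.
by split=> [[]//|H]; split => //; apply/(Wv H); rewrite u0.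
Qed.

Lemma gram_schmidt_after_neq0 ys ps b :
  b \in @gram_schmidt_after R n ys ps -> b != 0.
Proof.
move=> bB; have /andP[_ /allP] := gram_schmidt_orthogonal (ys ++ ps).
by apply; rewrite gram_schmidt_cat mem_cat bB orbT.
Qed.

Lemma gram_schmidt_after_orthogonal ys ps :
  {in @gram_schmidt_after R n ys ps &, forall b b', b != b' -> mpdot b b' = 0}.
Proof.
move=> b b' bB b'B; apply: (orthogonal_systemP (gram_schmidt_orthogonal (ys ++ ps)));
by rewrite gram_schmidt_cat mem_cat ?bB ?b'B orbT.
Qed.

Lemma gram_schmidt_after_uniq ys ps : uniq (@gram_schmidt_after R n ys ps).
Proof. exact/drop_uniq/orthogonal_system_uniq/gram_schmidt_orthogonal. Qed.

(** The vectors orthogonal to a fixed [b] form a subspace, so [y] may be replaced by the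
    orthogonalized vectors of [ys], which precede [b] in one orthogonal system. *)
Lemma gram_schmidt_after_perp ys ps y b :
  y \in ys -> b \in @gram_schmidt_after R n ys ps -> mpdot y b = 0.
Proof.
move=> yys bB; move: y yys.
apply/(gram_schmidt_span (W := [set p | mpdot p b = 0])) => /=.
- by rewrite mpdot0l.
- by move=> a p q pb qb; rewrite mpdotDl mpdotZl pb qb mulr0 addr0.
move=> u uys; have := orthogonal_system_uniq (gram_schmidt_orthogonal (ys ++ ps)).
rewrite gram_schmidt_cat cat_uniq => /and3P[_ /hasPn /(_ _ bB) ub _].
apply: (orthogonal_systemP (gram_schmidt_orthogonal (ys ++ ps))).
- by rewrite gram_schmidt_cat mem_cat uys.
- by rewrite gram_schmidt_cat mem_cat bB orbT.
- by apply: contraNneq ub => <-.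
Qed.

Lemma mpdot_homog_neq k l p q : p \is k.-homog -> q \is l.-homog -> k != l ->
  mpdot p q = 0.
Proof.
move=> hp hq kl; rewrite /mpdot big_seq big1// => m mp.
by rewrite (dhomog_nemf_coeff hq) ?rmorph0 ?mulr0// (dhomog_mf hp mp).
Qed.

End GramSchmidt.

(** * Lower bound for the number of generators *)

(* The generators are independent modulo the product of the ideal with the
   irrelevant ideal; the constant coefficients of the change of generators give
   a linear map that cannot be injective on a space of larger dimension. *)
Lemma leq_card_generators (K : fieldType) (n : nat) (T : finType) (M : nat)
    (g : T -> {mpoly K[n]}) (h : 'I_M -> {mpoly K[n]}) :
  (forall (v : T -> K) (e : T -> {mpoly K[n]}), (forall u, (e u)@_0%MM = 0) ->
     \sum_u v u *: g u = \sum_u e u * g u -> forall u, v u = 0) ->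
  ideal_gen (range g) = ideal_gen (range h) -> (#|T| <= M)%N.
Proof.
move=> indep gh; rewrite leqNgt; apply/negP => ltM.
have /boolp.choice[b bE] u : exists c : 'I_M -> {mpoly K[n]}, g u = \sum_j c j * h j.
  by apply: ideal_gen_range; rewrite -gh; apply: mem_ideal_gen; exists u.
have /boolp.choice[a aE] j : exists c : T -> {mpoly K[n]}, h j = \sum_u c u * g u.
  by apply: ideal_gen_range; rewrite gh; apply: mem_ideal_gen; exists j.
(* The matrix consists of the constant coefficients of the [b u j]; the null vector [v] makes the
   constant coefficient of every [w j] below vanish. *)
have [v [u vu] v0] := exists_left_null (fun u j => (b u j)@_0%MM) ltM.
pose w j := \sum_u v u *: b u j.
suff /(indep v) H : \sum_u v u *: g u = \sum_u (\sum_j w j * a j u) * g u.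
  move/eqP: vu; apply; apply: H => u'.
  rewrite raddf_sum big1// => j _.
  rewrite [LHS](rmorphM (mcoeff 0%MM)) /= [X in X * _](_ : _ = 0) ?mul0r//.
  rewrite raddf_sum -[RHS](v0 j); apply: eq_bigr => u'' _.
  exact: mcoeffZ.
transitivity (\sum_j w j * h j).
  under eq_bigr do rewrite bE scaler_sumr.
  rewrite exchange_big; apply: eq_bigr => j _; rewrite mulr_suml.
  by apply: eq_bigr => u' _; rewrite scalerAl.
under eq_bigr do rewrite aE mulr_sumr.
rewrite exchange_big; apply: eq_bigr => u' _; rewrite mulr_suml.
by apply: eq_bigr => j _; rewrite mulrA.
Qed.

Lemma card_le_setT_ord (T : finType) : [set: T] #<= `I_#|T|.
Proof.
have /finite_setP[k Tk] := @finite_finset T setT.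
rewrite (card_le_eql Tk) card_le_II -(card_fset_set Tk) cardE.
by apply: uniq_leq_size => [|x _]; [exact: finmap.fset_uniq|rewrite mem_enum].
Qed.

(** An infinite competitor [G'] dominates every countable set. A finite one is enumerated by some
    ['I_M], and the counting bound applies. *)
Lemma minimal_generators_range (K : fieldType) (n : nat) (T : finType)
    (g : T -> {mpoly K[n]}) :
  (forall (v : T -> K) (e : T -> {mpoly K[n]}), (forall u, (e u)@_0%MM = 0) ->
     \sum_u v u *: g u = \sum_u e u * g u -> forall u, v u = 0) ->
  minimal_generators (ideal_gen (range g)) (range g).
Proof.
move=> indep; split=> //; first by apply: finite_image; exact: finite_finset.
move=> G' genG'; have [G'fin|/infiniteP] := pselect (finite_set G'); last first.
  move=> natG'; apply: card_le_trans natG'; apply: card_le_trans (card_image_le _ _) _.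
  by apply: finite_set_countable; exact: finite_finset.
have /finite_setP[M G'M] := G'fin.
rewrite (card_le_eqr G'M); apply: card_le_trans (card_image_le _ _) _.
apply: card_le_trans (card_le_setT_ord T) _; rewrite card_le_II.
pose s := finmap.enum_fset (fset_set G').
have sM : size s = M by exact: card_fset_set.
apply: (leq_card_generators (h := fun i : 'I_M => s`_i) indep).
rewrite -genG'; congr ideal_gen; rewrite -[LHS](fset_setK G'fin).
apply/seteqP; split=> [x|_ [i _ <-]].
  rewrite /= -[x \in _]/(x \in s) => xs.
  have xM : (index x s < M)%N by rewrite -sM index_mem.
  by exists (Ordinal xM) => //=; rewrite nth_index.
by rewrite /= -[_ \in _]/(_ \in s) mem_nth// sM.
Qed.

(** * Generation and independence for the graded Gram-Schmidt families *)

Section GradedGramSchmidt.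
Context (R : realType) (n : nat) (r : nat) (k N : 'I_r -> nat)
  (p : forall s : 'I_r, 'I_(N s) -> {mpoly R[i][n]})
  (Y B : 'I_r -> seq {mpoly R[i][n]}).
Arguments p : clear implicits.
Hypothesis k_mono : forall s t : 'I_r, (s < t)%N -> (k s < k t)%N.
Hypothesis p_homog : forall s j, p s j \is (k s).-homog.
Hypothesis Y_def : forall s, [set` Y s] =
  [set x | exists (t : 'I_r) (q : {mpoly R[i][n]}) (a : 'X_{1..n}),
    [/\ (t < s)%N, q \in B t, mdeg a = (k s - k t)%N & x = 'X_[a] * q]].
Hypothesis B_def : forall s,
  B s = gram_schmidt_after (Y s) [seq p s j | j <- enum 'I_(N s)].

Let vs s := Y s ++ [seq p s j | j <- enum 'I_(N s)].

Let gsE s : gram_schmidt (vs s) = gram_schmidt (Y s) ++ B s.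
Proof. by rewrite B_def gram_schmidt_cat. Qed.

Let YP s x : x \in Y s -> exists (t : 'I_r) (q : {mpoly R[i][n]}) (a : 'X_{1..n}),
    [/\ (t < s)%N, q \in B t, mdeg a = (k s - k t)%N & x = 'X_[a] * q].
Proof. by move=> xY; have : [set` Y s] x by []; rewrite Y_def. Qed.

(* Strong induction along the degrees for predicates closed under the
   operations by which the sets B_s are produced. *)
Let B_ind (W : 'I_r -> set {mpoly R[i][n]}) :
  (forall s, W s 0) ->
  (forall s a x y, W s x -> W s y -> W s (a *: x + y)) ->
  (forall (s t : 'I_r) a q, (t < s)%N -> mdeg a = (k s - k t)%N -> W t q ->
     W s ('X_[a] * q)) ->
  (forall s j, W s (p s j)) ->
  forall s b, b \in B s -> W s b.
Proof.
move=> W0 WD WX Wp s; have [m] := ubnP (s : nat); elim: m s => // m IH s sm b bB.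
have [H _] := gram_schmidt_span (vs s) (W0 s) (WD s).
apply: H; last by rewrite gsE mem_cat bB orbT.
move=> v; rewrite mem_cat => /orP[/YP[t [q [a [ts qB am ->]]]]|/mapP[j _ ->]].
  by apply: WX am _ => //; apply: IH qB; apply: leq_trans ts _.
exact: Wp.
Qed.

Lemma graded_gram_schmidt_homog s q : q \in B s -> q \is (k s).-homog.
Proof.
apply: (B_ind (W := fun s q => q \is (k s).-homog)) => //.
- by move=> s'; exact: rpred0.
- by move=> s' a x y hx hy; rewrite rpredD ?rpredZ.
move=> s' t a q' ts am hq.
rewrite -(subnK (ltnW (k_mono ts))) -am; apply: dhomogM => //.
by rewrite dhomogX.
Qed.

(** Generators are indexed by a degree index and a position in the corresponding list, which turns
    the union of the [B s] into one finite family. *)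
Let T := {s : 'I_r & 'I_(size (B s))}.
Let g (u : T) := (B (tag u))`_(tagged u).

Let gB u : g u \in B (tag u).
Proof. exact: mem_nth. Qed.

Lemma graded_gram_schmidt_range :
  \bigcup_(s in [set: 'I_r]) [set` B s] = range g.
Proof.
apply/seteqP; split=> [b [s _ /= bB]|_ [u _ <-]]; last by exists (tag u) => //; exact: gB.
have ib : (index b (B s) < size (B s))%N by rewrite index_mem.
by exists (Tagged (fun s => 'I_(size (B s))) (Ordinal ib)); rewrite // /g /= nth_index.
Qed.

Lemma graded_gram_schmidt_gen :
  ideal_gen (\bigcup_(s in [set: 'I_r]) [set` B s]) =
  ideal_gen [set q | exists s j, q = p s j].
Proof.
have scale (I : set {mpoly R[i][n]}) : is_ideal I ->
    forall a x y, I x -> I y -> I (a *: x + y).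
  by move=> [_ ID IM] a x y Ix Iy; apply: ID => //; rewrite -mul_mpolyC; apply: IM.
apply/seteqP; split; apply: ideal_gen_sub; do ?exact: ideal_gen_ideal.
  move=> b [s _ /= bB]; have [I0 ID IM] := ideal_gen_ideal [set q | exists s j, q = p s j].
  apply: (B_ind (W := fun=> _) _ _ _ _ bB) => //.
  - by move=> _; apply: scale; exact: ideal_gen_ideal.
  - by move=> *; apply: IM.
  - by move=> s' j; apply: mem_ideal_gen; exists s', j.
move=> _ [s [j ->]]; set J := ideal_gen _.
have Jid : is_ideal J := ideal_gen_ideal _.
have [J0 _ JM] := Jid.
have BJ t b : b \in B t -> J b by move=> bB; apply: mem_ideal_gen; exists t.
have YJ x : x \in Y s -> J x.
  by move=> /YP[t [q [a [_ qB _ ->]]]]; apply: JM; exact: BJ qB.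
(* The span is used backwards here: once the Gram-Schmidt output on [Y s] and the list [B s] lie in
   [J], so do the inputs [p s j]. *)
have [_ H] := gram_schmidt_span (vs s) J0 (scale _ Jid).
apply: H; last by rewrite mem_cat map_f ?orbT// mem_enum.
move=> u; rewrite gsE mem_cat => /orP[|]; last exact: BJ.
by have [HY _] := gram_schmidt_span (Y s) J0 (scale _ Jid); apply: HY.
Qed.

(* Pairing with [g u] is a functional that only sees degree [k (tag u)], where
   the multiples of the other generators by nonconstant monomials lie in the
   span of [Y (tag u)]. *)
Lemma graded_gram_schmidt_independent (v : T -> R[i]) (e : T -> {mpoly R[i][n]}) :
  (forall u, (e u)@_0%MM = 0) ->
  \sum_u v u *: g u = \sum_u e u * g u -> forall u, v u = 0.
Proof.
move=> e0 ve u.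
have gg w : w != u -> mpdot (g w) (g u) = 0.
  have [E|ts] := eqVneq (k (tag w)) (k (tag u)); last first.
    by move=> _; apply: (mpdot_homog_neq _ _ ts); apply: graded_gram_schmidt_homog; exact: gB.
  have {E}tE : tag w = tag u.
    by apply: ord_inj; case: (ltngtP (tag w) (tag u)) => // /k_mono; rewrite E ltnn.
  clear e0 ve; case: w u tE => [t i] [s j] /= E; subst s => ij.
  rewrite /g /=; have B_uniq : uniq (B t) by rewrite B_def gram_schmidt_after_uniq.
  apply: (gram_schmidt_after_orthogonal (ys := Y t)
    (ps := [seq p t j' | j' <- enum 'I_(N t)])); rewrite -?B_def ?mem_nth//.
  apply: contraNneq ij => /eqP; rewrite nth_uniq// => /eqP/val_inj ->.
  exact: eqxx.
have Xg a w : a != 0%MM -> mpdot ('X_[a] * g w) (g u) = 0.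
  move=> a0; have [E|ne] := eqVneq (mdeg a + k (tag w))%N (k (tag u)); last first.
    apply: (mpdot_homog_neq _ _ ne); last exact: graded_gram_schmidt_homog (gB _).
    by apply: dhomogM; [rewrite dhomogX|exact: graded_gram_schmidt_homog (gB _)].
  (* A nonconstant monomial has positive degree, so [g w] has smaller degree than [g u], hence a
     smaller index as [k] is increasing; the product then belongs to [Y (tag u)]. *)
  have kwu : (k (tag w) < k (tag u))%N by rewrite -E -[ltnLHS]add0n ltn_add2r lt0n mdeg_eq0.
  have wu : (tag w < tag u)%N.
    rewrite ltnNge; apply: contraTN kwu; rewrite -leqNgt leq_eqVlt.
    by move=> /predU1P[/ord_inj ->//|/k_mono/ltnW].
  have bB : g u \in @gram_schmidt_after R n (Y (tag u))
      [seq p (tag u) j | j <- enum 'I_(N (tag u))].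
    by rewrite -B_def; exact: gB.
  apply: gram_schmidt_after_perp bB.
  suff : [set` Y (tag u)] ('X_[a] * g w) by [].
  rewrite Y_def; exists (tag w), (g w), a.
  by split; [exact: wu|exact: gB|rewrite -E addnK|].
(* After pairing with [g u] the right side vanishes, since no [e w] has a constant term, and the
   left side reduces to [v u] times the nonzero number [mpdot (g u) (g u)]. *)
move/(congr1 (fun q => @mpdot R n q (g u))): ve => /=.
rewrite !mpdot_suml [X in _ = X -> _]big1 => [|w _]; last first.
  rewrite [e w]mpolyE mulr_suml mpdot_suml big1// => a _.
  rewrite -scalerAl mpdotZl; have [->|a0] := eqVneq a 0%MM.
    by rewrite e0 mul0r.
  by rewrite Xg// mulr0.
rewrite (bigD1 u)//= big1 ?addr0 => [|w wu]; last by rewrite mpdotZl gg// mulr0.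
rewrite mpdotZl => /eqP; rewrite mulf_eq0 mpdot_eq0 => /orP[/eqP//|/eqP gu0].
have := gB u; rewrite B_def => /gram_schmidt_after_neq0.
by rewrite gu0 eqxx.
Qed.
End GradedGramSchmidt.

(** * Separation from a subspace in finite dimension *)

(** [W] is the row space of a matrix of maximal rank among those with rows in [W]; some column of
    its cokernel matrix does not annihilate [v]. *)
Lemma separating_functional (K : fieldType) (d : nat) (W : set 'rV[K]_d)
    (v : 'rV[K]_d) :
  W 0 -> (forall a x y, W x -> W y -> W (a *: x + y)) -> ~ W v ->
  exists2 c : 'cV[K]_d, forall w, W w -> w *m c = 0 & v *m c != 0.
Proof.
move=> W0 WD Wv.
pose Q r := `[< exists m (A : 'M[K]_(m, d)), (forall i, W (row i A)) /\ \rank A = r >].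
have Q0 : exists r, Q r.
  exists 0%N; apply/asboolP; exists 0%N, 0; split; last by rewrite mxrank0.
  by case.
have Qd r : Q r -> (r <= d)%N by move=> /asboolP[m [A [_ <-]]]; exact: rank_leq_col.
case: (ex_maxnP Q0 Qd) => _ /asboolP[m [A [WA <-]]] rmax.
(* Appending to [A] a row of [W] outside its row space would raise the maximal rank. *)
have WsubA (w : 'rV_d) : W w -> (w <= A)%MS.
  move=> Ww; apply: contraT => wA.
  have /rmax : Q (\rank (col_mx A w)).
    apply/asboolP; exists (m + 1)%N, (col_mx A w); split=> // i.
    case: (split_ordP i) => j ->; first by rewrite rowKu.
    by rewrite rowKd row_id.
  rewrite -addsmxE leqNgt rank_ltmx// /ltmx addsmxSl /=.
  by apply: contra wA => /(submx_trans (addsmxSr A w)).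
have Asub (w : 'rV_d) : (w <= A)%MS -> W w.
  move=> /submxP[x ->]; rewrite mulmx_sum_row; apply: big_ind => //.
    by move=> y z Wy Wz; rewrite -[y]scale1r; apply: WD.
  by move=> i _; rewrite -[_ *: _]addr0; apply: WD.
have /rV0Pn[j vj] : v *m cokermx A != 0 by rewrite -submxE; apply/negP => /Asub.
exists (col j (cokermx A)) => [w /WsubA|].
  by rewrite submxE colE mulmxA => /eqP ->; rewrite mul0mx.
rewrite colE mulmxA -colE; apply: contraNneq vj => /matrixP/(_ 0 0).
by rewrite !mxE => ->.
Qed.

(** * Homogeneous components of polynomials and of ideals *)

Section HomogeneousComponents.
Context (K : comNzRingType) (n : nat).
Implicit Types (p q : {mpoly K[n]}) (I : set {mpoly K[n]}).

Lemma pihomogMhomog d k p q : q \is d.-homog ->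
  pihomog mdeg k (p * q) =
    if (d <= k)%N then pihomog mdeg (k - d) p * q else 0.
Proof.
move=> hq; rewrite {1}[p]mpolyE mulr_suml raddf_sum /=.
have E m : pihomog mdeg k (p@_m *: 'X_[m] * q) =
    if (mdeg m + d == k)%N then p@_m *: 'X_[m] * q else 0.
  have h : p@_m *: 'X_[m] * q \is (mdeg m + d).-homog.
    by apply: dhomogM => //; rewrite dhomogZ// dhomogX.
  by case: eqVneq => [<-|ne]; [rewrite pihomog_dE|rewrite (pihomog_ne0 ne)].
under eq_bigr do rewrite E.
case: leqP => [dk|kd].
  rewrite pihomogE mulr_suml [RHS]big_mkcond; apply: eq_bigr => m _.
  by rewrite -[in RHS](eqn_add2r d) subnK.
rewrite big1// => m _; case: eqP => // mk.
by move: kd; rewrite -mk ltnNge leq_addl.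
Qed.

Lemma mcoeff_pihomog k p m :
  (pihomog mdeg k p)@_m = if mdeg m == k then p@_m else 0.
Proof.
case: eqVneq => [mk|mk]; last by rewrite (dhomog_nemf_coeff (pihomogP _ _ _)).
(* The cut-off is enlarged beyond [k], so that [k] is a summation index even when it exceeds the
   degree of [p]. *)
have kD : (k < maxn k.+1 (mmeasure mdeg p))%N by rewrite leq_max leqnn.
rewrite [in RHS](pihomog_partitionE (leq_maxr k.+1 (mmeasure mdeg p))).
rewrite [RHS]raddf_sum [RHS](bigD1 (Ordinal kD))//= [X in _ = _ + X]big1 ?addr0// => d dk.
apply: (dhomog_nemf_coeff (pihomogP _ _ _)).
apply: contraNneq dk => E; apply/eqP/val_inj.
exact: etrans (esym E) mk.
Qed.

(** The polynomials all of whose components lie in the ideal form an ideal themselves, and it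
    contains the homogeneous generators. *)
Lemma homogeneous_ideal_pihomog I p k :
  homogeneous_ideal I -> I p -> I (pihomog mdeg k p).
Proof.
move=> [Iid [S Shom <-]]; have Jid := ideal_gen_ideal S.
have [J0 JD JM] := Jid.
move=> /(ideal_gen_sub (I := [set p | forall k, ideal_gen S (pihomog mdeg k p)])).
apply=> {p k}.
  split=> [k|p q Jp Jq k|a p Jp k]; rewrite /=.
  - by rewrite raddf0.
  - by rewrite raddfD; apply: JD; [exact: Jp|exact: Jq].
  (* Here the member [p] is split, not the multiplier [a]: each term becomes zero or a multiple of a
     component of [p], which lies in the ideal by [Jp]. *)
  rewrite (pihomog_partitionE (leqnn (mmeasure mdeg p))) mulr_sumr raddf_sum.
  apply: ideal_sum => // d _.
  rewrite [X in ideal_gen S X](pihomogMhomog _ _ (pihomogP mdeg d p)).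
  by case: ifP => // _; apply: JM; exact: Jp.
move=> p Sp k /=; have /homogP[d hp] := Shom _ Sp.
have [<-|dk] := eqVneq d k; first by rewrite pihomog_dE//; exact: mem_ideal_gen.
by rewrite (pihomog_ne0 dk).
Qed.

End HomogeneousComponents.

Lemma closure_normP (K : numFieldType) (V : normedModType K) (A : set V) (x : V) :
  closure A x <-> forall e : K, 0 < e -> exists2 y, A y & `|x - y| < e.
Proof.
split=> [Ax e e0|H U /nbhs_ballP[e /= e0 eU]].
  by have [y [Ay]] := Ax _ (nbhsx_ballx x e e0); rewrite -ball_normE; exists y.
have [y Ay xy] := H e e0; exists y; split=> //; apply: eU.
by rewrite -ball_normE.
Qed.

Lemma closed_subspace_smallest (R : realType) (n : nat) (S : set (hardy R n)) :
  closed_subspace (smallest (@closed_subspace R n) S).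
Proof.
split.
- by move=> F [[]].
- move=> a f g Sf Sg F FS; case: (FS) => -[_ FD _] _.
  by apply: FD; [exact: Sf|exact: Sg].
- by apply: closed_bigI => F [[]].
Qed.

(** * Polynomials and coordinate shifts in the Hardy space *)

Section Hardy.
Context (R : realType) (n : nat).
Local Notation P := {mpoly R[i][n]}.
Local Notation H := (hardy R n).
Local Notation normc := ComplexField.Normc.normc.
Local Notation h := (@hardy_of_mpoly R n).
Implicit Types (f g : H) (p q : P).

Lemma hardy_eqP f g : (forall m, f m = g m) -> f = g.
Proof. by move=> fg; apply/val_inj/funext. Qed.

Lemma hardy_coefD f g m : (f + g) m = f m + g m. Proof. by []. Qed.
Lemma hardy_coefZ (a : R[i]) f m : (a *: f) m = a * f m. Proof. by []. Qed.
Lemma hardy_coefB f g m : (f - g) m = f m - g m. Proof. by []. Qed.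

Lemma hardy_coef_sum (T : Type) (r : seq T) (S : pred T) (F : T -> H) m :
  (\sum_(i <- r | S i) F i) m = \sum_(i <- r | S i) F i m.
Proof. by elim/big_rec2: _ => [|i x y _ <-]. Qed.

Lemma hardy_of_mpolyP (a : R[i]) p q : h (a *: p + q) = a *: h p + h q.
Proof. by apply: hardy_eqP => m; rewrite hardy_coefD hardy_coefZ /= mcoeffD mcoeffZ. Qed.

Lemma hardy_of_mpoly0 : h 0 = 0.
Proof. by apply: hardy_eqP => m /=; rewrite mcoeff0. Qed.

Lemma hardy_of_mpoly_sum (T : Type) (r : seq T) (S : pred T) (F : T -> P) :
  h (\sum_(i <- r | S i) F i) = \sum_(i <- r | S i) h (F i).
Proof.
elim/big_rec2: _ => [|i x y _ <-]; first exact: hardy_of_mpoly0.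
by rewrite -[F i]scale1r hardy_of_mpolyP !scale1r.
Qed.

Lemma normcE (z : R[i]) : `|z| = (normc z)%:C.
Proof. by rewrite normc_def; case: z. Qed.

Lemma hardy_normE f : `|f| = (l2norm f)%:C. Proof. by []. Qed.

Lemma norm_hardy_coef_le f m : `|f m| <= `|f|.
Proof.
rewrite normcE hardy_normE lecR -ler_sqr ?nnegrE ?normc_ge0 ?l2norm_ge0//.
by have := square_summable_sum_le (s := [:: m]) (hardy_coefP f) isT; rewrite big_seq1.
Qed.

Lemma MzB i f g : Mz i (f - g) = Mz i f - Mz i g.
Proof.
apply: hardy_eqP => m; rewrite hardy_coefB /= /shift_coef.
by case: ifP; rewrite ?subr0.
Qed.

Lemma Mz_hardy_of_mpoly i p : Mz i (h p) = h ('X_i * p).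
Proof.
apply: hardy_eqP => m /=; rewrite /shift_coef.
case: eqVneq => [mi|mi]; last first.
  have mE : (U_(i) + (m - U_(i)))%MM = m by rewrite addmC submK// lep1mP.
  rewrite -[in RHS]mE mulrC.
  by rewrite -[RHS]/((p * 'X_[U_(i)])@_(U_(i) + (m - U_(i))%MM)) mcoeffMX.
rewrite mcoeffM big1// => -[k1 k2] /= /eqP mE; rewrite mcoeffX.
case: eqVneq => [k1E|_]; last by rewrite mul0r.
by have := congr1 (fun m' : 'X_{1..n} => m' i) mE; rewrite -k1E mnmDE mnm1E eqxx mi.
Qed.

(** The shift merely relocates coefficients: lowering the exponent of [z_i] is injective where that
    exponent is nonzero, and the other coefficients are zero. *)
Lemma norm_Mz_le i f : `|Mz i f| <= `|f|.
Proof.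
rewrite !hardy_normE lecR.
apply: (square_summable_bound (l2norm_ge0 f) _).2 => s us.
rewrite (bigID (fun m : 'X_{1..n} => m i == 0%N)) /= big1 ?add0r; last first.
  by move=> m m0; rewrite /shift_coef m0 sqr_normc0.
under eq_bigr => m m0 do rewrite /shift_coef (negbTE m0).
rewrite -big_filter -(big_map (fun m => (m - U_(i))%MM) xpredT (fun m => normc (f m) ^+ 2)).
apply: square_summable_sum_le; first exact: hardy_coefP.
rewrite map_inj_in_uniq ?filter_uniq// => m m'; rewrite !mem_filter.
move=> /andP[m0 _] /andP[m0' _] E.
have K (m1 : 'X_{1..n}) : m1 i != 0%N -> (m1 - U_(i) + U_(i))%MM = m1.
  by move=> ?; rewrite submK// lep1mP.
by rewrite -(K m)// E K.
Qed.

(** * The closure of a homogeneous ideal *)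

Section HomogeneousIdeal.
Variable I : set P.
Hypothesis Ihom : homogeneous_ideal I.
Let Iid : is_ideal I := Ihom.1.
Local Notation M := (closure (h @` I) : set H).

Let ID a p q : I p -> I q -> I (a *: p + q).
Proof.
by case: Iid => _ D Mu Ip Iq; apply: D => //; rewrite -mul_mpolyC; apply: Mu.
Qed.

Lemma closure_ideal_subspace : closed_subspace M.
Proof.
split; last exact: closed_closure.
  apply: subset_closure; exists 0; first by case: Iid.
  exact: hardy_of_mpoly0.
move=> a f g /closure_normP Mf /closure_normP Mg; apply/closure_normP => e e0.
(* The added 1 permits division when [a] is zero. *)
have a1 : 0 < `|a| + 1 by rewrite ltr_wpDl.
have [_ [p Ip <-] fp] := Mf (e / 2 / (`|a| + 1)) (divr_gt0 (divr_gt0 e0 (ltr0Sn _ 1)) a1).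
have [_ [q Iq <-] gq] := Mg (e / 2) (divr_gt0 e0 (ltr0Sn _ 1)).
exists (h (a *: p + q)); first by exists (a *: p + q) => //; apply: ID.
rewrite hardy_of_mpolyP opprD addrACA -scalerBr.
apply: (le_lt_trans (ler_normD _ _)); rewrite [e]splitr normrZ ltr_leD// ?ltW//.
apply: (@le_lt_trans _ _ ((`|a| + 1) * `|f - h p|)).
  by rewrite ler_wpM2r// lerDl.
by rewrite mulrC -ltr_pdivlMr.
Qed.

Lemma closure_ideal_Mz_invariant : Mz_invariant M.
Proof.
move=> i _ [f /closure_normP Mf <-]; apply/closure_normP => e /Mf[_ [p Ip <-] fp].
exists (h ('X_i * p)); first by exists ('X_i * p) => //; case: Iid => _ _; apply.
by rewrite -Mz_hardy_of_mpoly -MzB (le_lt_trans (norm_Mz_le _ _)).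
Qed.

Lemma closure_ideal_homog k p : p \is k.-homog -> M (h p) -> I p.
Proof.
move=> hp Mp; apply: contrapT => Ip.
(* [T] lists the monomials of degree exactly [k], and [rho] below reads off the corresponding Taylor
   coefficients. *)
pose T : finType := {m : 'X_{1..n < k.+1} | mdeg m == k}.
pose mon (i : 'I_#|T|) : 'X_{1..n} := val (val (enum_val i)).
have mon_deg i : mdeg (mon i) = k by apply/eqP; exact: (valP (enum_val i)).
have monP m : mdeg m = k -> exists i, m = mon i.
  move=> mk; have mk1 : (mdeg m < k.+1)%N by rewrite mk.
  have mk2 : mdeg (BMultinom mk1) == k by apply/eqP.
  by exists (enum_rank (Sub (BMultinom mk1) mk2 : T)); rewrite /mon enum_rankK.
pose rho (f : 'X_{1..n} -> R[i]) : 'rV[R[i]]_#|T| := \row_i f (mon i).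
pose W : set 'rV_#|T| := [set rho (h q) | q in I].
have W0 : W 0.
  exists 0; first by case: Iid.
  by apply/rowP => i; rewrite !mxE /= mcoeff0.
have WD a x y : W x -> W y -> W (a *: x + y).
  move=> [q Iq <-] [q' Iq' <-]; exists (a *: q + q'); first exact: ID.
  by rewrite hardy_of_mpolyP; apply/rowP => i; rewrite !mxE.
(* In the first case [p] has the same coefficients of degree [k] as some [q] in [I], so [p] is a
   component of [q] and lies in [I]. *)
have [[q Iq /rowP qp]|c cW cp] := separating_functional W0 WD (v := rho (h p)).
  apply: Ip; suff -> : p = pihomog mdeg k q by exact: homogeneous_ideal_pihomog.
  apply/mpolyP => m; rewrite mcoeff_pihomog; case: eqVneq => mk; last first.
    by rewrite (dhomog_nemf_coeff hp).
  by have [i ->] := monP m mk; have := qp i; rewrite !mxE.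
pose phi f : R[i] := \sum_i f (mon i) * c i 0.
have phiE f : (rho f *m c) 0 0 = phi f.
  by rewrite mxE; apply: eq_bigr => i _; rewrite mxE.
(* A bound for the norm of [phi]; the summand 1 keeps it positive. *)
pose C : R[i] := 1 + \sum_i `|c i 0|.
have C0 : 0 < C by rewrite ltr_wpDr// sumr_ge0.
have phi_le f : `|phi f| <= C * `|f|.
  apply: (le_trans (ler_norm_sum _ _ _)).
  apply: (@le_trans _ _ (\sum_i `|c i 0| * `|f|)).
    apply: ler_sum => i _; rewrite normrM mulrC ler_wpM2l//.
    exact: norm_hardy_coef_le.
  by rewrite -mulr_suml ler_wpM2r// lerDr.
have phip : 0 < `|phi (h p)|.
  rewrite normr_gt0 -phiE; apply: contraNneq cp => c0; apply/eqP/matrixP => i j.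
  by rewrite !ord1 c0 mxE.
move/closure_normP/(_ _ (divr_gt0 phip C0)) : Mp => [_ [q Iq <-]].
rewrite ltr_pdivlMr// mulrC => lt_phi.
(* As [phi] vanishes on [I], an approximation of [h p] by [h q] closer than [|phi (h p)| / C]
   contradicts the bound. *)
suff E : phi (h p) = phi (h p - h q).
  by have := le_lt_trans (phi_le (h p - h q)) lt_phi; rewrite E ltxx.
have Wq : W (rho (h q)) by exists q.
have /matrixP/(_ 0 0) := cW _ Wq.
rewrite phiE mxE => q0; rewrite -[LHS]subr0 -q0 /phi -sumrB.
by apply: eq_bigr => i _; rewrite hardy_coefB mulrBl.
Qed.

(** A closed subspace containing all homogeneous parts of [M] contains each polynomial of [I] as the
    sum of its components, hence also the closure. *)
Lemma closure_ideal_homogeneous : homogeneous_subspace M.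
Proof.
apply/seteqP; split; last first.
  apply: smallest_sub; first exact: closure_ideal_subspace.
  by move=> f [k _ []].
have [S0 SD Scl] := closed_subspace_smallest (\bigcup_k (M `&` @hardy_homog R n k)).
rewrite [X in X `<=` _]closureE; apply: (smallest_sub Scl) => _ [p Ip <-].
rewrite (pihomog_partitionE (leqnn (mmeasure mdeg p))) hardy_of_mpoly_sum.
apply: big_ind => // [f g Sf Sg|d _]; first by rewrite -[f]scale1r; apply: SD.
apply: sub_gen_smallest; exists (d : nat) => //; split.
  by apply: subset_closure; exists (pihomog mdeg d p) => //; apply: homogeneous_ideal_pihomog.
by exists (pihomog mdeg d p) => //=; exact: pihomogP.
Qed.

Lemma ideal_direct_sum :
  algebraic_direct_sum (h @` I) (fun d => M `&` @hardy_homog R n d).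
Proof.
split.
  apply/seteqP; split=> [_ [p Ip <-]|_ [d [f [fM ->]]]].
    exists (mmeasure mdeg p), (fun k => h (pihomog mdeg k p)); split=> [k _|].
      split; last by exists (pihomog mdeg k p) => //=; exact: pihomogP.
      by apply: subset_closure; exists (pihomog mdeg k p) => //; apply: homogeneous_ideal_pihomog.
    by rewrite {1}(pihomog_partitionE (leqnn (mmeasure mdeg p))) hardy_of_mpoly_sum.
  apply: big_ind => [|_ _ [p Ip <-] [q Iq <-]|k _].
  - by exists 0; [case: Iid|exact: hardy_of_mpoly0].
  - by exists (1 *: p + q); [exact: ID|rewrite hardy_of_mpolyP scale1r].
  (* Homogeneous elements of the closure come back to [I] itself by [closure_ideal_homog]. *)
  have [Mf [q /= hq qf]] := fM k (ltn_ord k); exists q => //.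
  by apply: (closure_ideal_homog hq); rewrite qf.
move=> d f fM f0 k kd; apply: hardy_eqP => m.
(* Independence is read off coefficientwise: only the summand of index [mdeg m] can have a nonzero
   coefficient at [m]. *)
have fhom j : (j < d)%N -> mdeg m != j -> f j m = 0.
  by move=> jd mj; have [_ [q /= hq <-]] := fM j jd; rewrite /= (dhomog_nemf_coeff hq).
have [mk|/(fhom _ kd)//] := eqVneq (mdeg m) k.
have : (\sum_(j < d) f j) m = 0 by rewrite f0.
rewrite hardy_coef_sum (bigD1 (Ordinal kd))//= big1 ?addr0// => j jk.
apply: fhom => //; rewrite mk eq_sym.
by apply: contraNneq jk => jk; apply/eqP/val_inj.
Qed.

End HomogeneousIdeal.
End Hardy.

Theorem mainTheorem5 (R : realType) (n : nat) (I : set {mpoly R[i][n]}) :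
  homogeneous_ideal I ->
  let M : set (hardy R n) := closure (@hardy_of_mpoly R n @` I) in
  [/\ closed_subspace M,
      homogeneous_subspace M,
      Mz_invariant M &
      algebraic_direct_sum (@hardy_of_mpoly R n @` I)
        (fun d => M `&` hardy_homog d)] /\
  forall (r : nat) (k N : 'I_r -> nat)
    (p : forall s : 'I_r, 'I_(N s) -> {mpoly R[i][n]})
    (Y B : 'I_r -> seq {mpoly R[i][n]}),
  (forall s t : 'I_r, (s < t)%N -> (k s < k t)%N) ->
  (forall s, (1 <= N s)%N) ->
  (forall s j, p s j \is (k s).-homog) ->
  (forall s j, p s j != 0) ->
  ideal_gen [set q | exists s j, q = p s j] = I ->
  (forall s, [set` Y s] =
     [set x | exists (t : 'I_r) (q : {mpoly R[i][n]}) (a : 'X_{1..n}),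
        [/\ (t < s)%N, q \in B t, mdeg a = (k s - k t)%N & x = 'X_[a] * q]]) ->
  (forall s, B s = gram_schmidt_after (Y s) [seq p s j | j <- enum 'I_(N s)]) ->
  (forall s q, q \in B s -> q \is (k s).-homog) /\
  minimal_generators I (\bigcup_(s in [set: 'I_r]) [set` B s]).
Proof.
move=> Ihom M; split.
  split; [exact: closure_ideal_subspace|exact: closure_ideal_homogeneous|
    exact: closure_ideal_Mz_invariant|exact: ideal_direct_sum].
move=> r k N p Y B k_mono _ p_homog _ genI Y_def B_def; split.
  exact: (graded_gram_schmidt_homog k_mono p_homog Y_def B_def).
have gI := graded_gram_schmidt_gen Y_def B_def.
rewrite genI graded_gram_schmidt_range in gI *.
rewrite -{1}gI; apply: minimal_generators_range.
exact: (graded_gram_schmidt_independent k_mono p_homog Y_def B_def).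
Qed.
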